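(* Let $\mathcal{H}$ be a complex Hilbert space, let $T,S\in\mathcal{B}(\mathcal{H})$, let $q\in(0,1]$, let $n$ be a positive integer, and let $\omega=e^{2\pi \mathrm{i}/n}$. Let $\mathbb{P}$ be the $n\times n$ tridiagonal operator matrix $$\mathbb{P}=\begin{bmatrix} T & \omega^{n-1}S & O & \cdots & O\\ \omega S & T & \omega^{n-1}S & \cdots & \vdots\\ O & \omega S & T & \ddots & O\\ \vdots & \vdots & \ddots & \ddots & \omega^{n-1}S\\ O & O & \cdots & \omega S & T\end{bmatrix}$$ acting on $\bigoplus_{j=1}^n\mathcal{H}$ (diagonal entries $T$, entries immediately above the diagonal $\omega^{n-1}S$, entries immediately below the diagonal $\omega S$, all other entries $O$). Then $$\max_{1\le k\le n} w_q\left(T+\left(2\cos\frac{k\pi}{n+1}\right)S\right)\le w_q(\mathbb{P})\le \frac{q+2\sqrt{1-q^2}}{q}\max_{1\le k\le n} w_q\left(T+\left(2\cos\frac{k\pi}{n+1}\right)S\right).$$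
   Context: $\mathcal{B}(\mathcal{K})$ denotes the bounded linear operators on a complex Hilbert space $\mathcal{K}$; $O$ is the zero operator. An $n\times n$ matrix $[S_{ij}]$ with entries in $\mathcal{B}(\mathcal{H})$ acts on $\bigoplus_{j=1}^n\mathcal{H}$ (with the direct-sum inner product) by $(x_1,\dots,x_n)\mapsto(\sum_j S_{1j}x_j,\dots,\sum_j S_{nj}x_j)$. For $A\in\mathcal{B}(\mathcal{K})$ and a scalar $q$ with $|q|\le 1$, the $q$-numerical range is $W_q(A)=\{\langle Ax,y\rangle: x,y\in\mathcal{K},\ \|x\|=\|y\|=1,\ \langle x,y\rangle=q\}$ and the $q$-numerical radius is $w_q(A)=\sup\{|z|: z\in W_q(A)\}$. In the degenerate case $\dim\mathcal{K}=1$, where $A$ is a scalar $c$ and $W_q(A)$ is empty for $0<q<1$, the convention is $w_q(A)=q|c|$. *)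

(* Defs.v *)
From HB Require Import structures.
From mathcomp Require Import all_boot all_order all_algebra complex.
From mathcomp Require Import all_classical all_reals all_analysis.

Set Implicit Arguments.
Unset Strict Implicit.
Unset Printing Implicit Defensive.

Import Order.TTheory GRing.Theory Num.Theory Num.Def.
Import numFieldNormedType.Exports.

Local Open Scope ring_scope.
Local Open Scope complex_scope.
Local Open Scope classical_set_scope.

(* A complex Hilbert space is a [H : completeNormedModType R[i]] with an inner
   product [dot : {dot H for conjC}] (linear in the first argument,
   conjugate-linear in the second) that induces the norm of [H].  The
   q-numerical range and radius only involve the linear structure and [dot]. *)
Definition induces_norm (R : realType) (H : completeNormedModType R[i])
    (dot : {dot H for (@conjC R[i])}) : Prop :=
  forall x : H, `|x| = sqrtC (dot x x).

Definition bounded_op (R : realType) (H : normedModType R[i])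
    (A : {linear H -> H}) : Prop :=
  exists M : R, forall x : H, `|A x| <= M%:C * `|x|.

Section QRadius.
Variables (R : realType) (K : lmodType R[i]).
Variables (dot : {dot K for (@conjC R[i])}) (q : R[i]) (A : K -> K).

Definition qrange : set R[i] :=
  [set z | exists x y : K, [/\ sqrtC (dot x x) = 1, sqrtC (dot y y) = 1,
                               dot x y = q & z = dot (A x) y]].

Definition one_dimensional : Prop :=
  exists2 e : K, e != 0 & forall x : K, exists c : R[i], x = c *: e.

Definition scalar_of : R[i] := xget 0 [set c | forall x : K, A x = c *: x].

(* In dimension 1 the range is empty for |q| < 1 and the radius is |q||c| by
   convention; for |q| = 1 this is also the value of the supremum.  On the zero
   space the range is empty and the radius is [sup set0 = 0]. *)
Definition qradius : R :=
  if `[< one_dimensional >] then Normc.normc q * Normc.normc scalar_of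
  else sup [set Normc.normc z | z in qrange].

(* Hence [\big[Num.max/0]] over a nonempty range is the genuine maximum. *)
Lemma qradius_ge0 : 0 <= qradius.
Proof.
have n0 (z : R[i]) : 0 <= Normc.normc z by case: z => a b; exact: sqrtr_ge0.
rewrite /qradius; case: asboolP => _; first by rewrite mulr_ge0.
set X := image _ _; have [supX|/sup_out->//] := pselect (has_sup X).
have [x Xx] := supX.1; apply: le_trans (sup_upper_bound supX Xx).
by have [z _ <-] := Xx.
Qed.

End QRadius.

Section DirectSum.
Variables (R : realType) (H : lmodType R[i]) (n : nat).

Definition dsum_dot (dot : {dot H for (@conjC R[i])})
    (x y : {ffun 'I_n -> H}) : R[i] := \sum_i dot (x i) (y i).

Section DirectSumDot.
Variable dot : {dot H for (@conjC R[i])}.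

Fact dsum_dot_bilinear :
  bilinear_for ( *%R ) ((@conjC R[i]) \; *%R) (dsum_dot dot).
Proof.
split=> [y|x] a u v /=; rewrite /dsum_dot mulr_sumr -big_split;
  apply: eq_bigr => i _ /=; rewrite !ffunE.
- by rewrite linearPl.
- by rewrite linearPr.
Qed.

HB.instance Definition _ :=
  bilinear_isBilinear.Build R[i] _ _ _ _ _ (dsum_dot dot) dsum_dot_bilinear.

Fact dsum_dot_hermitian x y :
  dsum_dot dot x y = (-1) ^+ false * (dsum_dot dot y x)^*%R.
Proof.
rewrite /dsum_dot rmorph_sum mulr_sumr; apply: eq_bigr => i _.
exact: hermitian_subproof.
Qed.

HB.instance Definition _ :=
  isHermitianSesquilinear.Build R[i] _ false _ (dsum_dot dot) dsum_dot_hermitian.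

Fact dsum_dot_gt0 x : x != 0 -> 0 < dsum_dot dot x x.
Proof.
move=> x0; rewrite lt_neqAle sumr_ge0 ?andbT => [|i _]; last exact: dnorm_ge0.
rewrite eq_sym; apply: contra x0.
rewrite psumr_eq0 => [/allP/= x0|i _]; last exact: dnorm_ge0.
apply/eqP/ffunP => i; rewrite ffunE; apply/eqP.
by have := x0 i (mem_index_enum _); rewrite dnorm_eq0.
Qed.

HB.instance Definition _ := isDotProduct.Build R[i] _ (dsum_dot dot) dsum_dot_gt0.

End DirectSumDot.

Definition opmx (M : 'M[H -> H]_n) (x : {ffun 'I_n -> H}) : {ffun 'I_n -> H} :=
  [ffun i => \sum_j M i j (x j)].

End DirectSum.

(* exp (2 i pi / n) *)
Definition omega (R : realType) (n : nat) : R[i] :=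
  cos (2 * pi / n%:R) +i* sin (2 * pi / n%:R).

Definition tridiag_mx (R : realType) (H : lmodType R[i]) (n : nat)
    (T S : H -> H) : 'M[H -> H]_n :=
  \matrix_(i < n, j < n)
    if j == i :> nat then T
    else if j == i.+1 :> nat then omega R n ^+ n.-1 \*: S
    else if i == j.+1 :> nat then omega R n \*: S
    else fun=> 0.

(* Main.v *)
Require Import Defs.
From mathcomp Require Import all_boot all_order all_algebra complex.
From mathcomp Require Import all_classical all_reals all_analysis.
From mathcomp Require Import ring zify.

Set Implicit Arguments.
Unset Strict Implicit.
Unset Printing Implicit Defensive.

Import Order.TTheory GRing.Theory Num.Theory Num.Def.
Import numFieldNormedType.Exports.

Local Open Scope ring_scope.
Local Open Scope complex_scope.

(** Conjugating P by the diagonal unitary with entries 1, w, w^2, ... (w the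
    n-th root of unity) removes the powers of w, leaving T on the diagonal and
    S on both adjacent diagonals.  The scalar matrix with ones on these two
    diagonals has the orthogonal eigenvectors (sin (j k pi / (n + 1)))_j, with
    eigenvalues 2 cos (k pi / (n + 1)).  Hence P is unitarily equivalent to the
    direct sum of the operators A_k = T + 2 cos (k pi / (n + 1)) S: there are
    isometries V_k of H into the direct sum, with orthogonal ranges spanning it,
    such that P V_k = V_k A_k ([tridiag_eigenvector], [sine_mx_unitary]).

    Lower bound: V_k maps the pairs that define the q-numerical range of A_k to
    pairs for P, so the first range is contained in the second
    ([qradius_isometry]).

    Upper bound: three facts about the ordinary numerical radius w(A), the
    least w with |<A x, x>| <= w <x, x>, are combined.
    - q w(A) <= w_q(A).  For a unit vector x and a unit vector z orthogonal to
      it, both y = q x + s z and y = q x - s z with s = sqrt (1 - q^2) are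
      admissible; averaging the two values of <A x, y> leaves q <A x, x>
      ([numerical_bound_qradius]).
    - w of a direct sum is the maximum of the w's of the summands
      ([numerical_bound_dsum]).
    - w_q(A) <= (q + 2 s) w(A).  Write y = q x + s z with z orthogonal to x; by
      polarization |<A x, z>| <= 2 w(A) ([qrange_bound], [qradius_le]).
    Thus w(P) <= max_k w_q(A_k) / q and w_q(P) <= (q + 2 s) w(P).

    Both bounds on the q-numerical radius hold in dimension one thanks to the
    convention made there, so the spaces of dimension one need a separate
    argument only inside these general lemmas. *)

(** * Numerical and q-numerical radius of one operator *)

(** Operators such as P are bare functions with a proof of linearity, hence
    these two facts for functions that carry no linear structure. *)
Section LinearFun.
Variables (F : pzRingType) (U V : lmodType F) (f : U -> V).
Hypothesis linf : linear f.

Lemma linear_fun0 : f 0 = 0.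
Proof. by have := linf (-1) 0 0; rewrite scaler0 addr0 scaleN1r addNr. Qed.

Lemma linear_funZ c x : f (c *: x) = c *: f x.
Proof. by have := linf c x 0; rewrite !addr0 linear_fun0 addr0. Qed.

End LinearFun.

Section NumericalRadius.
Variables (R : realType) (K : lmodType R[i]).
Variable dot : {dot K for (@conjC R[i])}.
Implicit Types (x y z : K) (A : K -> K) (w q : R).

(** The numerical radius enters only through its upper bounds, which avoids
    suprema. *)
Definition numerical_bound A w : Prop :=
  forall x, `|dot (A x) x| <= w%:C * dot x x.

Lemma dotC x y : dot x y = (dot y x)^*%R.
Proof. by have := hermC dot x y; rewrite expr0 mul1r. Qed.

Lemma dotZl a x y : dot (a *: x) y = a * dot x y.
Proof. by rewrite linearZl_LR. Qed.

Lemma dotZr a x y : dot x (a *: y) = a^*%R * dot x y.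
Proof. by rewrite linearZr_LR. Qed.

Lemma dotDl x y z : dot (x + y) z = dot x z + dot y z.
Proof. exact: linearDl. Qed.

Lemma dotDr x y z : dot x (y + z) = dot x y + dot x z.
Proof. exact: linearDr. Qed.

Lemma dot_ge0 x : 0 <= dot x x. Proof. exact: dnorm_ge0. Qed.

Lemma dot_eq0 x : (dot x x == 0) = (x == 0). Proof. exact: dnorm_eq0. Qed.

Lemma sqrt_dot1 x : sqrtC (dot x x) = 1 <-> dot x x = 1.
Proof.
split=> [h|->]; last exact: sqrtC1.
by rewrite -(sqrtCK (dot x x)) h expr1n.
Qed.

Lemma normcC (z : R[i]) : (Normc.normc z)%:C = `|z|. Proof. by []. Qed.

Lemma conj_real (t : R) : (t%:C)^*%R = t%:C :> R[i].
Proof. exact: conjc_real. Qed.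

Lemma conj_i_exp k : (('i%R : R[i]) ^+ k)^*%R = (- 'i%R) ^+ k.
Proof. by rewrite rmorphXn /= conjCi. Qed.

Lemma cube_i : 'i%R ^+ 3 = - 'i%R :> R[i].
Proof. by rewrite exprS sqrCi mulrN1. Qed.

Lemma cube_Ni : (- 'i%R) ^+ 3 = 'i%R :> R[i].
Proof. by rewrite exprS sqrrN sqrCi mulrN1 opprK. Qed.

(** Summing over the fourth roots of unity c kills the terms weighted by c and
    by c^2 and keeps the single one weighted by c times its conjugate. *)
Lemma polarization A x z : linear A ->
  4 * dot (A x) z =
    \sum_(k < 4) 'i%R ^+ k * dot (A ('i%R ^+ k *: z + x)) ('i%R ^+ k *: z + x).
Proof.
move=> linA; rewrite !big_ord_recr big_ord0 /=.
rewrite !linA !dotDl !dotDr !dotZl !dotZr !conj_i_exp.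
move: (dot _ _) (dot _ _) (dot _ _) (dot _ _) => a b c d.
rewrite !(expr0, expr1, sqrrN, sqrCi, cube_i, cube_Ni).
have i2 : 'i%R * 'i%R = -1 :> R[i] by rewrite -expr2 sqrCi.
move: 'i%R i2 => i i2.
(* The two sides differ by a multiple of 1 + i * i. *)
transitivity (4 * d + (1 + i * i) * (2 * b - 2 * d)); last by ring.
by rewrite i2 subrr mul0r addr0.
Qed.

Lemma parallelogram x z :
  \sum_(k < 4) dot ('i%R ^+ k *: z + x) ('i%R ^+ k *: z + x) =
    4 * (dot x x + dot z z).
Proof.
rewrite !big_ord_recr big_ord0 /= !dotDl !dotDr !dotZl !dotZr !conj_i_exp.
move: (dot _ _) (dot _ _) (dot _ _) (dot _ _) => a b c d.
rewrite !(expr0, expr1, sqrrN, sqrCi, cube_i, cube_Ni).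
have i2 : 'i%R * 'i%R = -1 :> R[i] by rewrite -expr2 sqrCi.
move: 'i%R i2 => i i2.
(* The two sides differ by a multiple of 1 + i * i. *)
transitivity (4 * (a + d) + (1 + i * i) * (- 2 * d)); first by ring.
by rewrite i2 subrr mul0r addr0.
Qed.

(** For unit x and z this is the classical bound of the operator norm by twice
    the numerical radius. *)
Lemma offdiag_bound A w x z : linear A -> numerical_bound A w ->
  `|dot (A x) z| <= w%:C * (dot x x + dot z z).
Proof.
move=> linA Aw.
have n4 : 0 < 4%:R :> R[i] by rewrite ltr0n.
rewrite -(ler_pM2l n4) -[X in X * `|_|](gtr0_norm n4) -normrM polarization //.
rewrite mulrCA -parallelogram mulr_sumr (le_trans (ler_norm_sum _ _ _))//.
apply: ler_sum => k _; rewrite normrM normrX normCi expr1n mul1r.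
exact: Aw.
Qed.

(** The identity has numerical radius 1.  This coarse form of the Cauchy-Schwarz
    inequality is all that the finiteness of numerical radii requires. *)
Lemma dot_bound x z : `|dot x z| <= dot x x + dot z z.
Proof.
rewrite -[leRHS]mul1r; apply: (@offdiag_bound id 1) => // y.
by rewrite mul1r ger0_norm ?dot_ge0.
Qed.

(** The part of y orthogonal to x has length s = sqrt (1 - q^2), so that
    |<A x, y>| <= q |<A x, x>| + s |<A x, z>| for a unit vector z. *)
Lemma qrange_bound A w q : linear A -> numerical_bound A w ->
    0 <= q <= 1 -> forall c, qrange dot q%:C A c ->
  Normc.normc c <= (q + 2 * Num.sqrt (1 - q ^+ 2)) * w.
Proof.
move=> linA Aw /andP[q0 q1] _ [x [y [/sqrt_dot1 x1 /sqrt_dot1 y1 xyq ->]]].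
rewrite -lecR normcC.
set s := Num.sqrt (1 - q ^+ 2); pose r := y - q%:C *: x.
have s0 : 0 <= s by exact: sqrtr_ge0.
have s2 : s ^+ 2 = 1 - q ^+ 2 by rewrite sqr_sqrtr // subr_ge0 expr_le1.
have rr : dot r r = (s ^+ 2)%:C.
  have yx : dot y x = q%:C by rewrite dotC xyq conj_real.
  rewrite s2 /r -scaleN1r -[X in dot (X + _) _]scale1r.
  rewrite !(scalerA, dotDl, dotDr, dotZl, dotZr) x1 y1 xyq yx.
  have cN1 : (-1)^*%R = -1 :> R[i] by rewrite rmorphN1.
  by rewrite cN1 conj_real rmorphB rmorph1 rmorphXn /=; ring.
have -> : y = q%:C *: x + r by rewrite addrC subrK.
rewrite dotDr dotZr conj_real (le_trans (ler_normD _ _))//.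
rewrite mulrDl rmorphD /= lerD //.
  rewrite normrM rmorphM /= ger0_norm ?ler0c// ler_wpM2l ?ler0c//.
  by have := Aw x; rewrite x1 mulr1.
(* For q = 1 the orthogonal part vanishes and cannot be normalized. *)
have [s_eq0|sN0] := eqVneq s 0.
  have /eqP: dot r r = 0 by rewrite rr s_eq0 expr0n.
  by rewrite dot_eq0 => /eqP->; rewrite linear0r normr0 s_eq0 mulr0 mul0r.
have sC : s%:C != 0 :> R[i] by apply: contra sN0 => /eqP/complexI->.
pose z := s%:C^-1 *: r.
have zz : dot z z = 1.
  rewrite dotZl dotZr rr.
  have -> : (s%:C^-1)^*%R = s%:C^-1 :> R[i] by rewrite fmorphV /= conj_real.
  by rewrite mulrA -invfM -expr2 rmorphXn mulVf // expf_neq0.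
have -> : r = s%:C *: z by rewrite scalerA divff // scale1r.
rewrite dotZr conj_real normrM ger0_norm ?ler0c//.
have := offdiag_bound x z linA Aw; rewrite x1 zz => h.
rewrite [2 * s]mulrC -mulrA rmorphM ler_wpM2l ?ler0c//.
by rewrite (le_trans h)// rmorphM rmorph_nat mulrC.
Qed.


Lemma one_dim_scalar A : linear A -> one_dimensional K ->
  forall x, A x = scalar_of A *: x.
Proof.
move=> linA [e e0 span]; have [c Ae] := span (A e).
apply: (@xgetPex _ 0 [set c | forall x, A x = c *: x]); exists c => x /=.
have [d ->] := span x.
by rewrite linear_funZ // Ae !scalerA mulrC.
Qed.

Lemma normc_real (t : R) : 0 <= t -> Normc.normc t%:C = t.
Proof. by move=> t0; apply: complexI; rewrite normcC ger0_norm ?ler0c. Qed.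

(** On a line q |c| <= q w already suffices; elsewhere every point of the range
    obeys the bound, and an empty range has supremum 0, whence the sign
    condition on w. *)
Lemma qradius_le A w q : linear A -> numerical_bound A w -> 0 <= w ->
    0 <= q <= 1 ->
  qradius dot q%:C A <= (q + 2 * Num.sqrt (1 - q ^+ 2)) * w.
Proof.
move=> linA Aw w0 q01; have /andP[q0 q1] := q01; rewrite /qradius.
case: asboolP => [K1|_].
  rewrite normc_real // mulrDl -[leLHS]addr0 lerD //; last first.
    by rewrite !mulr_ge0 ?sqrtr_ge0.
  rewrite ler_wpM2l // -lecR normcC; have [e e0 _] := K1.
  have ee : 0 < dot e e by rewrite lt_def dot_eq0 e0 dot_ge0.
  rewrite -(ler_pM2r ee) -[X in _ * X <= _]gtr0_norm // -normrM.
  by rewrite -dotZl -one_dim_scalar.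
have bnd := qrange_bound linA Aw q01.
set X := image _ _; have [supX|/sup_out->] := pselect (has_sup X); last first.
  by rewrite mulr_ge0 // addr_ge0 // mulr_ge0 // sqrtr_ge0.
by apply: ge_sup => [|_ [c /bnd cb <-]]; first exact: supX.1.
Qed.

Lemma normalize x : x != 0 ->
  exists2 b : R[i], b != 0 & exists2 u, dot u u = 1 & x = b *: u.
Proof.
move=> x0; pose b := sqrtC (dot x x).
have b0 : b != 0 by rewrite sqrtC_eq0 dot_eq0.
exists b => //; exists (b^-1 *: x); last by rewrite scalerA divff ?scale1r.
have bJ : b^*%R = b by rewrite geC0_conj // sqrtC_ge0 dot_ge0.
by rewrite dotZl dotZr fmorphV /= bJ mulrA -invfM -expr2 sqrtCK mulVf ?dot_eq0.
Qed.

(** One Gram-Schmidt step applied to a vector outside the line spanned by x. *)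
Lemma exists_orthogonal x : x != 0 -> ~ one_dimensional K ->
  exists2 z, dot z z = 1 & dot z x = 0.
Proof.
move=> x0 K1.
have [y yx] : exists y, forall c, y != c *: x.
  apply: contrapT => h; apply: K1; exists x => // y.
  apply: contrapT => hy; apply: h; exists y => c; apply/eqP => yc.
  by apply: hy; exists c.
pose v := - (dot y x / dot x x) *: x + y.
have vx : dot v x = 0.
  by rewrite dotDl dotZl mulNr divfK ?dot_eq0// addNr.
have v0 : v != 0.
  by rewrite /v addrC scaleNr subr_eq0 yx.
have [b b0 [z zz vE]] := normalize v0; exists z => //.
by apply: (mulfI b0); rewrite mulr0 -dotZl -vE.
Qed.

(** The numerical bound makes the range bounded, so that its supremum is not the
    default value 0. *)
Lemma qrange_le_qradius A w q c : linear A -> numerical_bound A w ->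
    0 <= q <= 1 -> ~ one_dimensional K -> qrange dot q%:C A c ->
  Normc.normc c <= qradius dot q%:C A.
Proof.
move=> linA Aw q01 K1 qc; rewrite /qradius; case: asboolP => // _.
apply: sup_upper_bound; last by exists c.
split; first by exists (Normc.normc c), c.
exists ((q + 2 * Num.sqrt (1 - q ^+ 2)) * w) => _ [d qd <-].
exact: (qrange_bound linA Aw).
Qed.

(** This is q w(A) <= w_q(A): for unit vectors u orthogonal to z, the points
    q <A u, u> + t <A u, z> with t = sqrt (1 - q^2) and t = - sqrt (1 - q^2) lie
    in the range, and q <A u, u> is their mean.  On a line the convention gives
    equality.  The bound w makes the range bounded. *)
Lemma numerical_bound_qradius A w q : linear A -> numerical_bound A w ->
  0 < q <= 1 -> numerical_bound A (qradius dot q%:C A / q).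
Proof.
move=> linA Aw /andP[q0 q1] x.
have q01 : 0 <= q <= 1 by rewrite ltW.
have qC : 0 < q%:C :> R[i] by rewrite ltcR.
have A0 : A 0 = 0 by exact: linear_fun0.
have AZ c y : A (c *: y) = c *: A y by exact: linear_funZ.
have [->|x0] := eqVneq x 0.
  by rewrite A0 linear0r normr0 mulr0.
rewrite -(ler_pM2l qC) mulrA -[X in _ <= X * _]rmorphM /= mulrCA divff
  ?gt_eqF// mulr1.
have [K1|K1] := pselect (one_dimensional K).
  rewrite /qradius asboolT // one_dim_scalar // dotZl normrM.
  by rewrite (normc_real (ltW q0)) [X in _ <= X * _]rmorphM /= normcC mulrA
    (ger0_norm (dot_ge0 _)).
have [b b0 [u uu xE]] := normalize x0.
have [z zz zx] := exists_orthogonal x0 K1.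
have uz : dot u z = 0.
  by apply: (mulfI b0); rewrite -dotZl -xE mulr0 dotC zx rmorph0.
have {}zu : dot z u = 0 by rewrite dotC uz rmorph0.
have key (t : R) : t ^+ 2 = 1 - q ^+ 2 ->
    `|q%:C * dot (A u) u + t%:C * dot (A u) z| <= (qradius dot q%:C A)%:C.
  move=> t2; rewrite -normcC lecR; apply: (qrange_le_qradius linA Aw) => //.
  exists u, (q%:C *: u + t%:C *: z).
  split; try apply/sqrt_dot1; rewrite ?(dotDl, dotDr, dotZl, dotZr) ?conj_real //.
    rewrite uu zz uz zu !mulr0 addr0 add0r !mulr1 -!rmorphM -rmorphD /=.
    by rewrite -!expr2 t2 addrC subrK.
  by rewrite uu uz mulr1 mulr0 addr0.
have s2 : Num.sqrt (1 - q ^+ 2) ^+ 2 = 1 - q ^+ 2.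
  by rewrite sqr_sqrtr // subr_ge0 expr_le1 // ltW.
have n2 : 0 < 2%:R :> R[i] by rewrite ltr0n.
have hu : q%:C * `|dot (A u) u| <= (qradius dot q%:C A)%:C.
  rewrite -(ler_pM2l n2) -{1}(gtr0_norm n2) -{1}(gtr0_norm qC) -!normrM.
  rewrite [leRHS]mulrDl mul1r.
  have h1 := key _ s2.
  have h2 := key (- Num.sqrt (1 - q ^+ 2)) (etrans (sqrrN _) s2).
  apply: le_trans (lerD h1 h2); apply: le_trans (ler_normD _ _).
  by rewrite le_eqVlt; apply/predU1l; congr `|_|; rewrite rmorphN; ring.
rewrite xE AZ !dotZl !dotZr uu mulr1 mulrA -normCK normrM normrX normr_id.
by rewrite mulrCA [leRHS]mulrC ler_wpM2l // exprn_ge0.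
Qed.

End NumericalRadius.

(** * Compression along an isometry *)
Section Isometry.
Variables (R : realType) (H K : lmodType R[i]).
Variables (dotH : {dot H for (@conjC R[i])}) (dotK : {dot K for (@conjC R[i])}).
Variables (V : H -> K) (A : H -> H) (P : K -> K).
Hypothesis isoV : forall u v, dotK (V u) (V v) = dotH u v.
Hypothesis linV : linear V.
Hypothesis VA : forall u, P (V u) = V (A u).

Lemma qrange_isometry q : (qrange dotH q A `<=` qrange dotK q P)%classic.
Proof.
move=> _ [x [y [x1 y1 xyq ->]]]; exists (V x), (V y).
by rewrite VA !isoV.
Qed.

(** An isometry is injective, so a nonzero H inside a line is a line.  It rules
    out the convention on the larger space when it is not used on the smaller. *)
Lemma one_dimensional_isometry (x : H) :
  x != 0 -> one_dimensional K -> one_dimensional H.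
Proof.
move=> x0 [e e0 span]; exists x => // y.
have [a xa] := span (V x); have [b yb] := span (V y).
have Vx0 : V x != 0 by rewrite -(dot_eq0 dotK) isoV dot_eq0.
have a0 : a != 0 by apply: contra Vx0 => /eqP a0; rewrite xa a0 scale0r.
exists (b / a); apply/eqP; rewrite -subr_eq0 -(dot_eq0 dotH) -isoV dot_eq0.
have -> : y - (b / a) *: x = - (b / a) *: x + y by rewrite addrC scaleNr.
by rewrite linV xa yb scalerA mulNr divfK // scaleNr addNr.
Qed.

(** Outside dimension one this is the inclusion of ranges.  If H is a line, the
    inclusion says nothing, its range being empty for q < 1; but then the image
    of a spanning vector is an eigenvector of P for the scalar c equal to A, and
    q |c| <= w_q(P) by [numerical_bound_qradius]. *)
Lemma qradius_isometry w q : linear A -> linear P -> numerical_bound dotK P w ->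
  0 < q <= 1 -> qradius dotH q%:C A <= qradius dotK q%:C P.
Proof.
move=> linA linP Pw q01; have /andP[q0 q1] := q01.
have q01' : 0 <= q <= 1 by rewrite ltW.
rewrite [leLHS]/qradius; case: asboolP => [H1|H1].
  have [e e0 _] := H1; rewrite (normc_real (ltW q0)) mulrC -ler_pdivlMr //.
  rewrite -lecR normcC.
  have ee : 0 < dotH e e by rewrite lt_def dot_eq0 e0 dot_ge0.
  have := numerical_bound_qradius linP Pw q01 (V e).
  rewrite VA !isoV (one_dim_scalar linA H1) dotZl normrM (gtr0_norm ee).
  by rewrite ler_pM2r.
set X := image _ _; have [supX|/sup_out->] := pselect (has_sup X); last first.
  exact: qradius_ge0.
apply: ge_sup => [|_ [c qc <-]]; first exact: supX.1.
apply: (qrange_le_qradius linP Pw) => //; last exact: qrange_isometry.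
have [x [_ [/sqrt_dot1 x1 _ _ _]]] := qc.
move=> K1; apply: H1; apply: (@one_dimensional_isometry x) => //.
by rewrite -(dot_eq0 dotH) x1 oner_eq0.
Qed.

End Isometry.

(** * Operators diagonalized by a scalar unitary matrix *)
Section UnitaryCoordinates.
Variables (R : realType) (H : lmodType R[i]) (n : nat).
Variable dot : {dot H for (@conjC R[i])}.
Variable U : 'M[R[i]]_n.
Hypothesis unitaryU : U *m (map_mx conjC U)^T = 1%:M.

(** The embedding of H along the k-th row of U; the rows being orthonormal, these
    are isometries with pairwise orthogonal ranges. *)
Definition copy k (u : H) : {ffun 'I_n -> H} := [ffun j => U k j *: u].

(** The adjoint of [copy k]. *)
Definition coordinate k (x : {ffun 'I_n -> H}) : H := \sum_j (U k j)^*%R *: x j.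

Lemma linear_copy k : linear (copy k).
Proof.
move=> a u v; apply/ffunP => j; rewrite !ffunE scalerDr !scalerA.
by rewrite mulrC.
Qed.

Lemma dot_copy k l u v :
  dsum_dot dot (copy k u) (copy l v) = (k == l)%:R * dot u v.
Proof.
have -> : (k == l)%:R = (1%:M : 'M[R[i]]_n) k l by rewrite mxE.
rewrite -unitaryU mxE mulr_suml; apply: eq_bigr => j _.
by rewrite !ffunE !mxE dotZl dotZr mulrA.
Qed.

(** The columns of U are orthonormal too, since a one-sided inverse of a square
    matrix is two-sided. *)
Lemma sum_copy x : x = \sum_k copy k (coordinate k x).
Proof.
have UU : (map_mx conjC U)^T *m U = 1%:M by exact: mulmx1C.
apply/ffunP => i; rewrite sum_ffunE.
transitivity (\sum_j (1%:M : 'M[R[i]]_n) j i *: x j).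
  rewrite (bigD1 i) //= mxE eqxx scale1r big1 ?addr0 // => j ji.
  by rewrite mxE (negbTE ji) scale0r.
rewrite -UU; under eq_bigr do rewrite mxE scaler_suml.
rewrite exchange_big /=; apply: eq_bigr => k _.
rewrite ffunE /coordinate scaler_sumr; apply: eq_bigr => j _.
by rewrite !mxE scalerA mulrC.
Qed.

Lemma dsum_dot_coordinates (B : 'I_n -> H -> H)
    (P : {ffun 'I_n -> H} -> {ffun 'I_n -> H}) x :
  linear P -> (forall k u, P (copy k u) = copy k (B k u)) ->
  dsum_dot dot (P x) x =
    \sum_k dot (B k (coordinate k x)) (coordinate k x).
Proof.
move=> linP PB.
have PD : {morph P : u v / u + v}.
  by move=> u v; have := linP 1 u v; rewrite !scale1r.
have P0 : P 0 = 0 by exact: linear_fun0.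
rewrite {1 2}(sum_copy x) (big_morph P PD P0) linear_sumr; apply: eq_bigr => k _.
rewrite linear_sumlz (bigD1 k) //= PB dot_copy eqxx mul1r big1 ?addr0 // => l lk.
by rewrite PB dot_copy (negbTE lk) mul0r.
Qed.

(** P acts as B k on the k-th of the orthogonal copies of H, so <P x, x> is the
    sum of the <B k x_k, x_k>, while <x, x> is the sum of the <x_k, x_k>. *)
Lemma numerical_bound_dsum (B : 'I_n -> H -> H)
    (P : {ffun 'I_n -> H} -> {ffun 'I_n -> H}) w :
    linear P -> (forall k u, P (copy k u) = copy k (B k u)) ->
  (forall k, numerical_bound dot (B k) w) -> numerical_bound (dsum_dot dot) P w.
Proof.
move=> linP PB Bw x; rewrite /= (dsum_dot_coordinates x linP PB).
have -> : dsum_dot dot x x = \sum_k dot (coordinate k x) (coordinate k x).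
  (* The same formula with every operator the identity. *)
  exact: (@dsum_dot_coordinates (fun=> id) id).
rewrite mulr_sumr (le_trans (ler_norm_sum _ _ _)) //.
by apply: ler_sum => k _; exact: Bw.
Qed.

End UnitaryCoordinates.

(** * Bounded operators *)
Section BoundedOperators.
Variables (R : realType) (H : completeNormedModType R[i]).
Variable dot : {dot H for (@conjC R[i])}.
Hypothesis hdot : induces_norm dot.

(** |<A x, x>| <= <A x, A x> + <x, x> <= (M^2 + 1) <x, x>. *)
Lemma bounded_numerical_bound (A : {linear H -> H}) :
  bounded_op A -> exists w, numerical_bound dot A w.
Proof.
move=> [M AM]; exists (M ^+ 2 + 1) => x.
have nE y : `|y| ^+ 2 = dot y y by rewrite hdot sqrtCK.
rewrite (le_trans (dot_bound _ _ _)) // rmorphD rmorph1 mulrDl mul1r lerD2r.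
rewrite -!nE rmorphXn -exprMn; apply: lerXn2r => //; rewrite nnegrE //.
exact: le_trans (AM x).
Qed.

Lemma bounded_pencil (T S : {linear H -> H}) (c : R[i]) :
  bounded_op T -> bounded_op S ->
  exists w, numerical_bound dot (T \+ (c \*: S)) w.
Proof.
move=> /bounded_numerical_bound[t Tt] /bounded_numerical_bound[s Ss].
exists (t + Normc.normc c * s) => x /=; rewrite dotDl dotZl.
rewrite (le_trans (ler_normD _ _)) // normrM rmorphD rmorphM /= mulrDl.
by rewrite lerD // -mulrA ler_wpM2l.
Qed.
End BoundedOperators.

(** * The tridiagonal operator matrix and its eigenvectors *)
Section Omega.
Variables (R : realType).

Lemma expr_cis (a : R) m :
  (cos a +i* sin a) ^+ m = cos (m%:R * a) +i* sin (m%:R * a) :> R[i].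
Proof.
elim: m => [|m IH]; first by rewrite expr0 mul0r cos0 sin0.
rewrite exprSr IH -natr1 mulrDl mul1r cosD sinD.
by apply/eqP; rewrite eq_complex /= eqxx /= addrC eqxx.
Qed.

Lemma omegaXn n : (0 < n)%N -> omega R n ^+ n = 1.
Proof.
move=> n0; rewrite expr_cis mulrC divfK ?pnatr_eq0 -?lt0n //.
by rewrite mulr_natl cos2pi sin2pi.
Qed.

Lemma omegaJ n : omega R n * (omega R n)^*%R = 1.
Proof.
apply/eqP; rewrite eq_complex /=; apply/andP; split; apply/eqP; last by ring.
by rewrite mulrN opprK -!expr2 cos2Dsin2.
Qed.

End Omega.

Section Tridiagonal.
Variable R : realType.

Lemma tridiagonal_sum (W : nmodType) n (i : 'I_n) (F G K : nat -> W) :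
  \sum_(j < n) (if j == i :> nat then F j else if j == i.+1 :> nat then G j
                else if i == j.+1 :> nat then K j else 0) =
  F i + (if (i.+1 < n)%N then G i.+1 else 0) + (if (0 < i)%N then K i.-1 else 0).
Proof.
transitivity (\sum_(j < n) ((if j == i :> nat then F j else 0) +
   (if j == i.+1 :> nat then G j else 0) +
   (if (0 < i)%N && (j == i.-1 :> nat) then K j else 0))).
  apply: eq_bigr => j _; case: eqP => [->|ji].
    case: eqP => [|_]; first by move=> h; exfalso; lia.
    case: ifP => [h|]; last by rewrite !addr0.
    by exfalso; lia.
  case: eqP => [->|ji1].
    by case: ifP => [h|]; [exfalso; lia|rewrite add0r addr0].
  rewrite !add0r; congr (if _ then _ else _).
  by apply/eqP/idP; lia.
rewrite !big_split /= -!big_mkcond /= !big_ord1_eq ltn_ord.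
congr (_ + _ + _); case: posnP => [->|i0] /=; first by rewrite big_pred0_eq.
by rewrite big_ord1_eq ifT //; have := ltn_ord i; lia.
Qed.

Variables (H : lmodType R[i]) (n : nat) (T S : {linear H -> H}).
Hypothesis n_gt0 : (0 < n)%N.
Variables (b : nat -> R) (lambda : R).
Hypothesis b0 : b 0 = 0.
Hypothesis bn : b n.+1 = 0.
Hypothesis bS : forall j, b j + b j.+2 = lambda * b j.+1.

(** The weights w^j absorb the powers of w: as w^(n-1) w = 1, row i gives the
    common factor w^i to all three of its terms, leaving b i + b i.+2 in front
    of S.  The boundary values of b supply the terms missing from the first and
    last rows.  Entry j of the vector uses b j.+1, so that b 0 and b n.+1 are
    those boundary values. *)
Lemma tridiag_eigenvector (u : H) :
  opmx (tridiag_mx n T S)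
    [ffun j : 'I_n => (omega R n ^+ j * (b j.+1)%:C) *: u] =
  [ffun j : 'I_n =>
    (omega R n ^+ j * (b j.+1)%:C) *: (T \+ (lambda%:C \*: S)) u].
Proof.
apply/ffunP => i; rewrite !ffunE; set w := omega R n.
pose c j := w ^+ j * (b j.+1)%:C.
transitivity (\sum_(j < n) (if j == i :> nat then c j *: T u
   else if j == i.+1 :> nat then (w ^+ n.-1 * c j) *: S u
   else if i == j.+1 :> nat then (w * c j) *: S u else 0)).
  apply: eq_bigr => j _; rewrite mxE ffunE.
  do 3![case: ifP => _ /=; first by rewrite linearZ ?scalerA].
  by [].
rewrite (tridiagonal_sum i (fun j => c j *: T u)
  (fun j => (w ^+ n.-1 * c j) *: S u) (fun j => (w * c j) *: S u)).
have wn : w ^+ n.-1 * w = 1 by rewrite -exprSr prednK // omegaXn.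
have -> : (if (i.+1 < n)%N then (w ^+ n.-1 * c i.+1) *: S u else 0) =
    (w ^+ i * (b i.+2)%:C) *: S u.
  case: ltnP => [_|ni]; first by rewrite /c exprS !mulrA wn mul1r.
  have -> : i.+2 = n.+1 by have := ltn_ord i; lia.
  by rewrite bn mulr0 scale0r.
have -> : (if (0 < i)%N then (w * c i.-1) *: S u else 0) =
    (w ^+ i * (b i)%:C) *: S u.
  case: posnP => [->|i0]; first by rewrite b0 mulr0 scale0r.
  by rewrite /c mulrA -exprS prednK.
rewrite -addrA -scalerDl -mulrDr -rmorphD /= addrC [b _ + _]addrC bS.
by rewrite addrC scalerDr scalerA rmorphM [lambda%:C * _]mulrC mulrA.
Qed.

Lemma linear_opmx_tridiag : linear (opmx (tridiag_mx n T S)).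
Proof.
move=> a x y; apply/ffunP => i; rewrite !ffunE scaler_sumr -big_split.
apply: eq_bigr => j _; rewrite mxE !ffunE.
do 3![case: ifP => _ /=; first by rewrite linearP ?scalerDr // !scalerA mulrC].
by rewrite scaler0 addr0.
Qed.

End Tridiagonal.

(** * The orthonormal basis of sines *)
Section SineBasis.
Variables (R : realType) (n : nat).

Definition angle k : R := k%:R * pi / n.+1%:R.

Lemma sin_nat_pi k : sin (k%:R * pi) = 0 :> R.
Proof.
elim: k => [|k IH]; first by rewrite mul0r sin0.
by rewrite -natr1 mulrDl mul1r sinDpi IH oppr0.
Qed.

Lemma sin_angle_end k : sin (n.+1%:R * angle k) = 0.
Proof. by rewrite mulrC divfK ?pnatr_eq0 // sin_nat_pi. Qed.

Lemma sin_recurrence (t : R) j :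
  sin (j%:R * t) + sin (j.+2%:R * t) = 2 * cos t * sin (j.+1%:R * t).
Proof.
have -> : j%:R * t = j.+1%:R * t - t by rewrite -natr1; ring.
have -> : j.+2%:R * t = j.+1%:R * t + t by rewrite -[j.+2%:R]natr1; ring.
by rewrite sinB sinD; ring.
Qed.

Lemma angle_itv k : (0 < k < n.+1)%N -> 0 < angle k < pi.
Proof.
move=> /andP[k0 kn]; rewrite /angle divr_gt0 ?mulr_gt0 ?ltr0n ?pi_gt0 //=.
by rewrite ltr_pdivrMr ?ltr0n // mulrC ltr_pM2l ?pi_gt0 // ltr_nat.
Qed.

Lemma cos_angle_inj k l : (0 < k < n.+1)%N -> (0 < l < n.+1)%N ->
  cos (angle k) = cos (angle l) -> k = l.
Proof.
move=> kn ln; have /andP[k0 k1] := angle_itv kn; have /andP[l0 l1] := angle_itv ln.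
have n0 : n.+1%:R != 0 :> R by rewrite pnatr_eq0.
move=> /cos_inj; rewrite !in_itv /= !ltW // => /(_ isT isT).
move=> /(divIf n0) /(mulIf (lt0r_neq0 (pi_gt0 R))) /eqP.
by rewrite eqr_nat => /eqP.
Qed.

(** The classical argument for eigenvectors of a symmetric matrix: by the
    recurrence, the difference of the eigenvalues times the inner product
    telescopes, with vanishing boundary terms; and the eigenvalues are distinct
    because cos is injective on [0, pi]. *)
Lemma sum_sin_orthogonal k l : (0 < k < n.+1)%N -> (0 < l < n.+1)%N -> k != l ->
  \sum_(j < n) sin (j.+1%:R * angle k) * sin (j.+1%:R * angle l) = 0.
Proof.
move=> kn ln kl; set s := \sum_(_ < _) _.
(* The discrete Wronskian of the two solutions of the recurrence. *)
pose D j := sin (j%:R * angle k) * sin (j.+1%:R * angle l)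
          - sin (j.+1%:R * angle k) * sin (j%:R * angle l).
have : (2 * cos (angle k) - 2 * cos (angle l)) * s = 0.
  transitivity (\sum_(0 <= j < n) (- D j.+1 - - D j)).
    rewrite big_mkord mulr_sumr; apply: eq_bigr => j _.
    have hk := sin_recurrence (angle k) j; have hl := sin_recurrence (angle l) j.
    transitivity
      (2 * cos (angle k) * sin (j.+1%:R * angle k) * sin (j.+1%:R * angle l) -
       sin (j.+1%:R * angle k) * (2 * cos (angle l) * sin (j.+1%:R * angle l))).
      by ring.
    by rewrite -hk -hl /D; ring.
  rewrite telescope_sumr // /D !sin_angle_end !mul0r sin0.
  by rewrite !(mul0r, mulr0, subrr, oppr0).
move=> /eqP; rewrite mulf_eq0 => /orP[|/eqP//].
rewrite -mulrBr mulf_eq0 pnatr_eq0 /= subr_eq0 => /eqP /(cos_angle_inj kn ln).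
by move/eqP; rewrite (negbTE kl).
Qed.

Definition sine_norm k : R :=
  Num.sqrt (\sum_(j < n) sin (j.+1%:R * angle k) ^+ 2).

Lemma sine_norm_gt0 k : (0 < k < n.+1)%N -> 0 < sine_norm k.
Proof.
move=> kn; rewrite sqrtr_gt0.
have n0 : (0 < n)%N by lia.
(* The first entry is sin (angle k), with 0 < angle k < pi. *)
rewrite (bigD1 (Ordinal n0)) //= mul1r ltr_pwDl //.
  by rewrite exprn_gt0 // sin_gt0_pi // angle_itv.
by apply: sumr_ge0 => j _; exact: sqr_ge0.
Qed.

Definition sine_vector k j : R := sin (j%:R * angle k) / sine_norm k.

Lemma sine_vector_orthonormal (k l : 'I_n) :
  \sum_(j < n) sine_vector k.+1 j.+1 * sine_vector l.+1 j.+1 = (k == l)%:R.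
Proof.
have ord (i : 'I_n) : (0 < i.+1 < n.+1)%N by exact: (ltn_ord i).
have -> : \sum_(j < n) sine_vector k.+1 j.+1 * sine_vector l.+1 j.+1 =
    (\sum_(j < n) sin (j.+1%:R * angle k.+1) * sin (j.+1%:R * angle l.+1)) /
      (sine_norm k.+1 * sine_norm l.+1).
  by rewrite mulr_suml; apply: eq_bigr => j _; rewrite mulrACA -invfM.
case: eqVneq => [<-|kl]; last first.
  by rewrite sum_sin_orthogonal ?mul0r ?ord ?eqSS.
rewrite -expr2 sqr_sqrtr; last by apply: sumr_ge0 => j _; exact: sqr_ge0.
by apply: divff; have := sine_norm_gt0 (ord k); rewrite sqrtr_gt0 => /lt0r_neq0.
Qed.

(** Row k holds the eigenvector for the angle of index k.+1: the angles are
    numbered from 1, the rows from 0. *)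
Definition sine_mx : 'M[R[i]]_n :=
  \matrix_(k, j) (omega R n ^+ j * (sine_vector k.+1 j.+1)%:C).

Lemma sine_mx_unitary : sine_mx *m (map_mx conjC sine_mx)^T = 1%:M.
Proof.
apply/matrixP => k l; rewrite !mxE.
have -> : (k == l)%:R = ((k == l)%:R : R)%:C :> R[i] by rewrite rmorph_nat.
rewrite -sine_vector_orthonormal rmorph_sum; apply: eq_bigr => j _.
rewrite !mxE [RHS]rmorphM; move: (sine_vector _ _) (sine_vector _ _) => a b.
by rewrite rmorphM rmorphXn /= conj_real mulrACA -exprMn omegaJ expr1n mul1r.
Qed.

End SineBasis.

(** * The two inequalities *)
Theorem theorem3p3 (R : realType) (H : completeNormedModType R[i])
    (dot : {dot H for (@conjC R[i])}) (hdot : induces_norm dot)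
    (T S : {linear H -> H}) (hT : bounded_op T) (hS : bounded_op S)
    (q : R) (hq : 0 < q <= 1) (n : nat) (hn : (0 < n)%N) :
  let P : {ffun 'I_n -> H} -> {ffun 'I_n -> H} := opmx (tridiag_mx n T S) in
  let m : R := \big[Num.max/0]_(1 <= k < n.+1)
    qradius dot q%:C
      (T \+ ((2 * cos (k%:R * pi / n.+1%:R))%:C \*: S)) in
  m <= qradius (dsum_dot dot) q%:C P /\
  qradius (dsum_dot dot) q%:C P <= (q + 2 * Num.sqrt (1 - q ^+ 2)) / q * m.
Proof.
move=> P m; have /andP[q0 q1] := hq.
pose A k : H -> H := T \+ ((2 * cos (angle R n k))%:C \*: S).
have linA k : linear (A k).
  by move=> a x y; exact: linearP.
have Abnd k : exists w, numerical_bound dot (A k) w.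
  exact: bounded_pencil.
pose V (k : 'I_n) : H -> {ffun 'I_n -> H} := copy (sine_mx R n) k.
have PV k u : P (V k u) = V k (A k.+1 u).
  have VE v : V k v = [ffun j : 'I_n =>
      (omega R n ^+ j * (sine_vector R n k.+1 j.+1)%:C) *: v].
    by apply/ffunP => j; rewrite !ffunE mxE.
  rewrite !VE; apply: tridiag_eigenvector => //.
  - by rewrite /sine_vector mul0r sin0 mul0r.
  - by rewrite /sine_vector sin_angle_end mul0r.
  - by move=> j; rewrite /sine_vector -mulrDl sin_recurrence mulrA.
have linP : linear P by exact: linear_opmx_tridiag.
have mE : m = \big[Num.max/0]_(k < n) qradius dot q%:C (A k.+1).
  by rewrite /m big_add1 big_mkord.
have Am k : qradius dot q%:C (A (k : 'I_n).+1) <= m.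
  by rewrite mE; exact: le_bigmax.
have m0 : 0 <= m by rewrite mE; exact: bigmax_ge_id.
have Pm : numerical_bound (dsum_dot dot) P (m / q).
  apply: (numerical_bound_dsum (sine_mx_unitary R n) linP PV) => k x.
  have [w Aw] := Abnd k.+1.
  rewrite (le_trans (numerical_bound_qradius (linA _) Aw hq x)) //.
  by rewrite ler_wpM2r ?dot_ge0 // lecR ler_wpM2r // invr_ge0 ltW.
split; last first.
  rewrite mulrAC -mulrA; apply: qradius_le => //; last by rewrite ltW.
  by rewrite divr_ge0 // ltW.
rewrite mE; apply/bigmax_leP; split=> [|k _]; first exact: qradius_ge0.
apply: (@qradius_isometry _ _ _ _ _ (V k)) Pm hq => //.
- by move=> u v; rewrite /= (dot_copy _ (sine_mx_unitary R n)) eqxx mul1r.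
- exact: linear_copy.
Qed.
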